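(* Let $G$ be a finite simple graph with Dirac operator $D$, Dirac blocks $D_k=d_k^*d_k$ and squared analytic torsion $A(G)=\prod_{k}\mathrm{Det}(L_k)^{k(-1)^{k+1}}$. Then $$|\mathrm{Det}(D)|\cdot A(G)=\prod_{k\ \mathrm{even}}\mathrm{Det}(D_k)^2\qquad\text{and}\qquad |\mathrm{Det}(D)|/A(G)=\prod_{k\ \mathrm{odd}}\mathrm{Det}(D_k)^2 .$$
   Context: Let $G=(V,E)$ be a finite simple graph. A $k$-simplex of $G$ is (the vertex set of) a complete subgraph $K_{k+1}$; $f_k$ is the number of $k$-simplices, and $r$ is the maximal dimension of a simplex. Order the vertices; for a $(k+1)$-simplex $x=\{v_0<\dots<v_{k+1}\}$ and $y=x\setminus\{v_i\}$ put $\mathrm{sign}(y,x)=(-1)^i$. The exterior derivative $d_k$ is the $f_{k+1}\times f_k$ matrix given by $d_kf(x)=\sum_{y\subset x,\ \dim y=k}\mathrm{sign}(y,x)f(y)$ (with $d_{-1}=0$, $d_r=0$). These assemble to an $n\times n$ matrix $d$ on the space of functions on all $n=\sum_k f_k$ simplices; $D=d+d^*$ is the Dirac operator and $L=D^2$ the Hodge Laplacian, with diagonal blocks $L_k=d_k^*d_k+d_{k-1}d_{k-1}^*$, $0\le k\le r$. The Dirac blocks are $D_k=d_k^*d_k$, $0\le k\le r$. The pseudo determinant $\mathrm{Det}(M)$ of a square matrix $M$ is the product of its non-zero eigenvalues, counted with multiplicity (equal to $1$ if there are none). *)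

(* Defs.v *)
From HB Require Import structures.
From mathcomp Require Import all_boot all_order all_algebra.
From mathcomp Require Import spectral.

Set Implicit Arguments.
Unset Strict Implicit.
Unset Printing Implicit Defensive.

Import Order.TTheory GRing.Theory Num.Theory.

Local Open Scope ring_scope.
Local Open Scope sesquilinear_scope.

Section PseudoDeterminant.
Variable C : numClosedFieldType.

(* The eigenvalues of A in C, listed with algebraic multiplicity: the r such
   that char_poly A = \prod_(z <- r) ('X - z%:P). *)
Definition eigenvals n (A : 'M[C]_n) : seq C :=
  sval (closed_field_poly_normal (char_poly A)).

Definition pseudo_det n (A : 'M[C]_n) : C :=
  \prod_(z <- eigenvals A | z != 0) z.

End PseudoDeterminant.

Section CliqueComplex.
Variables (disp : Order.disp_t) (V : finOrderType disp) (e : rel V).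

Definition clique (x : {set V}) : bool :=
  [forall u in x, forall v in x, (u != v) ==> e u v].

Definition simplices (k : nat) : {set {set V}} :=
  [set x : {set V} | (#|x| == k.+1) && clique x].

Definition nsimpl (k : nat) : nat := #|simplices k|.

(* Equal to 0 when V is empty; then nsimpl 0 = 0 as well. *)
Definition max_dim : nat := (\max_(x : {set V} | clique x) #|x|).-1.

Section Operators.
Variable C : numClosedFieldType.

(* (-1)^i if y is x minus its vertex v_i, and 0 if y is not a facet of x: at
   most one v contributes, and the rank i of v in x is the number of vertices
   of x below v. *)
Definition facet_sign (y x : {set V}) : C :=
  \sum_(v in x | y == x :\ v) (-1) ^+ #|[set w in x | (w < v)%O]|.

Definition sign_mx (i j : nat) : 'M[C]_(nsimpl i, nsimpl j) :=
  \matrix_(a, b) facet_sign (enum_val b) (enum_val a).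

(* For k = max_dim there is no (k+1)-simplex, and d_k has no rows. *)
Definition ext_deriv (k : nat) : 'M[C]_(nsimpl k.+1, nsimpl k) :=
  sign_mx k.+1 k.

(* The (k+1, k) block is sign_mx k.+1 k, that is, ext_deriv k; writing it as
   sign_mx i j with i = j.+1 avoids a dimension cast. *)
Definition ext_deriv_all :
    'M[C]_(\sum_(i < max_dim.+1) nsimpl i) :=
  \mxblock_(i < max_dim.+1, j < max_dim.+1)
    (if i == j.+1 :> nat then sign_mx i j else 0).

Definition dirac : 'M[C]_(\sum_(i < max_dim.+1) nsimpl i) :=
  ext_deriv_all + ext_deriv_all ^t*.

Definition dirac_block (k : nat) : 'M[C]_(nsimpl k) :=
  (ext_deriv k) ^t* *m ext_deriv k.

Definition hodge_block (k : nat) : 'M[C]_(nsimpl k) :=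
  match k with
  | 0 => (ext_deriv 0) ^t* *m ext_deriv 0
  | j.+1 => (ext_deriv j.+1) ^t* *m ext_deriv j.+1
            + ext_deriv j *m (ext_deriv j) ^t*
  end.

Definition sq_torsion : C :=
  \prod_(k < max_dim.+1)
    pseudo_det (hodge_block k) ^ ((k : nat)%:Z * (-1) ^+ k.+1).

End Operators.
End CliqueComplex.

(* Main.v *)
Require Import Defs.
From mathcomp Require Import all_boot all_order all_algebra.
From mathcomp Require Import spectral.

Set Implicit Arguments.
Unset Strict Implicit.
Unset Printing Implicit Defensive.

Import Order.TTheory GRing.Theory Num.Theory.

Local Open Scope ring_scope.
Local Open Scope sesquilinear_scope.

(** Since [d d = 0], the products of [d^* d] and [d d^*] in either order vanish,
    so pseudo determinants multiply: [Det D ^ 2 = Det (D D) =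
    Det (d^* d) Det (d d^* )].  As [Det (A B) = Det (B A)], this is the square
    of [Det (d^* d)], the product of the positive numbers [Det D_k], and
    likewise [Det L_k = Det D_k * Det D_(k-1)].  The exponents in the torsion
    then telescope to [A(G) = \prod_k (Det D_k) ^ ((-1) ^ k)]; the boundary
    term at [k = r] is trivial because [d_r = 0]. *)

(** * Characteristic polynomial identities over a commutative ring *)

Section CharPoly.
Variable R : comNzRingType.

(* Both sides are the determinant of [block_mx 'X%:M A B 1%:M] times ['X^n]. *)
Lemma char_poly_mulC m n (A : 'M[R]_(m, n)) (B : 'M[R]_(n, m)) :
  'X^n * char_poly (A *m B) = 'X^m * char_poly (B *m A).
Proof.
pose A' := map_mx polyC A; pose B' := map_mx polyC B.
pose M := block_mx 'X%:M A' B' 1%:M.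
have detM : \det M = char_poly (A *m B).
  have : M *m block_mx 1%:M 0 (- B') 1%:M =
      block_mx ('X%:M - A' *m B') A' 0 1%:M.
    by rewrite mulmx_block !(mulmx1, mul1mx, mulmx0, mulmxN) add0r addrN add0r.
  move/(congr1 determinant).
  rewrite det_mulmx det_lblock det_ublock !det1 !mulr1.
  by move=> ->; rewrite /char_poly /char_poly_mx map_mxM.
have : block_mx 1%:M 0 (- B') 'X%:M *m M =
    block_mx 'X%:M A' 0 ('X%:M - B' *m A').
  rewrite mulmx_block !(mulmx1, mul1mx, mul0mx, mulNmx) !addr0.
  by rewrite scalar_mxC addNr [- _ + _]addrC.
move/(congr1 determinant).
rewrite det_mulmx det_lblock det_ublock det1 !det_scalar mul1r detM => ->.
by rewrite /char_poly /char_poly_mx map_mxM.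
Qed.

(** If A B = 0 then (X - A)(X - B) = X (X - (A + B)); take determinants. *)
Lemma char_polyD_orth n (A B : 'M[R]_n) :
  A *m B = 0 -> 'X^n * char_poly (A + B) = char_poly A * char_poly B.
Proof.
move=> AB0; rewrite /char_poly -det_scalar -!det_mulmx /char_poly_mx.
congr (\det _); rewrite map_mxD mulmxBl !mulmxBr -map_mxM AB0 map_mx0 subr0.
by rewrite mulmxDr opprD addrA addrAC -(scalar_mxC 'X (map_mx polyC A)).
Qed.

(** X^2 - A^2 = (X - A)(X + A), and writing X + A = -((-X) - A) produces the sign (-1)^n. *)
Lemma char_poly_sqr n (A : 'M[R]_n) :
  char_poly (A *m A) \Po 'X^2 =
    (-1) ^+ n * char_poly A * (char_poly A \Po (- 'X)).
Proof.
rewrite /char_poly -!det_map_mx -(det_scalar n (-1)) -!det_mulmx.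
congr (\det _).
rewrite /char_poly_mx !map_mxB !map_scalar_mx /= !comp_polyX map_mxM.
have compA q m (B : 'M[R]_m) :
    map_mx (comp_poly q) (map_mx polyC B) = map_mx polyC B.
  by apply/matrixP => i j; rewrite !mxE comp_polyC.
rewrite map_mxM !compA.
set A' := map_mx _ A.
rewrite mul_scalar_mx scaleN1r mulNmx -mulmxN opprB [(- 'X)%:M]raddfN opprK.
rewrite mulmxDr !mulmxBl -scalar_mxM scalar_mxC expr2.
by rewrite [RHS]addrC addrA subrK.
Qed.

Lemma char_poly_cast m n (e : m = n) (A : 'M[R]_m) :
  char_poly (castmx (e, e) A) = char_poly A.
Proof. by case: n / e; rewrite castmx_id. Qed.

Lemma char_poly_mxdiag m (p_ : 'I_m -> nat) (B_ : forall i, 'M[R]_(p_ i)) :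
  char_poly (\mxdiag_i B_ i) = \prod_i char_poly (B_ i).
Proof.
elim: m p_ B_ => [|m IHm] p_ B_.
  rewrite [RHS]big_ord0 /char_poly.
  (* The size is an empty sum; it can be rewritten to 0 once the matrix is generalised. *)
  move: (char_poly_mx _); rewrite big_ord0 => M.
  by rewrite det_mx00.
rewrite mxdiag_recl char_poly_cast big_ord_recl -IHm.
by rewrite /char_poly char_block_diag_mx det_ublock.
Qed.

End CharPoly.

(** * Pseudo determinants through lists of eigenvalues *)

Section PseudoDet.
Variable C : numClosedFieldType.

Lemma char_poly_eigenvals n (A : 'M[C]_n) :
  char_poly A = \prod_(z <- eigenvals A) ('X - z%:P).
Proof.
rewrite /eigenvals; case: closed_field_poly_normal => r /= Er.
by rewrite {1}Er (monicP (char_poly_monic A)) scale1r.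
Qed.

Lemma Xn_prod_XsubC k :
  'X^k = \prod_(z <- nseq k 0) ('X - z%:P) :> {poly C}.
Proof. by rewrite big_nseq subr0 iter_mulr mulr1. Qed.

(* The factor ['X^k] only adds zero eigenvalues, which [pseudo_det] ignores. *)
Lemma pseudo_det_roots n (A : 'M[C]_n) (s : seq C) k :
  'X^k * char_poly A = \prod_(z <- s) ('X - z%:P) ->
  pseudo_det A = \prod_(z <- s | z != 0) z.
Proof.
rewrite Xn_prod_XsubC char_poly_eigenvals -big_cat => /prod_XsubC_eq Es.
rewrite -(perm_big _ Es).
by rewrite big_cat big_nseq_cond eqxx /= mul1r.
Qed.

(** The size is a variable with an equation, to cover empty sums and values of [nsimpl] that are
    only provably 0. *)
Lemma pseudo_det_dim0 n (A : 'M[C]_n) : n = 0%N -> pseudo_det A = 1.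
Proof.
move=> n0; rewrite (@pseudo_det_roots _ _ [::] 0) ?big_nil // mul1r.
by subst n; rewrite /char_poly det_mx00.
Qed.

Lemma pseudo_det_mulmxC m n (A : 'M[C]_(m, n)) (B : 'M[C]_(n, m)) :
  pseudo_det (A *m B) = pseudo_det (B *m A).
Proof.
have := char_poly_mulC A B.
rewrite (Xn_prod_XsubC m) [char_poly (B *m A)]char_poly_eigenvals -big_cat.
move/pseudo_det_roots => ->; by rewrite big_cat big_nseq_cond eqxx /= mul1r.
Qed.

Lemma pseudo_detD_orth n (A B : 'M[C]_n) :
  A *m B = 0 -> pseudo_det (A + B) = pseudo_det A * pseudo_det B.
Proof.
move/char_polyD_orth; rewrite !char_poly_eigenvals -big_cat.
by rewrite -char_poly_eigenvals => /pseudo_det_roots ->; rewrite big_cat.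
Qed.

Lemma pseudo_det_sqr n (A : 'M[C]_n) :
  pseudo_det (A *m A) = pseudo_det A ^+ 2.
Proof.
suff /pseudo_det_roots -> : 'X^0 * char_poly (A *m A) =
    \prod_(z <- [seq z ^+ 2 | z <- eigenvals A]) ('X - z%:P).
  rewrite big_map /pseudo_det -prodrXl; apply: eq_bigl => z.
  by rewrite sqrf_eq0.
(* Composition with X^2 is injective, as it moves coefficient i to position 2i; so the identity may
   be checked after composing. *)
apply/polyP => i; rewrite mul1r.
have e (p : {poly C}) : p`_i = (p \Po 'X^2)`_(2 * i) :> C.
  by rewrite coef_comp_poly_Xn // dvdn_mulr // mulKn.
rewrite [LHS]e [RHS]e char_poly_sqr; congr (_`_ _).
(* Each eigenvalue z receives one factor -1, since -(X - z)(-X - z) = X^2 - z^2. *)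
have <- : \prod_(z <- eigenvals A) (-1) = (-1) ^+ n :> {poly C}.
  rewrite big_const_seq count_predT iter_mulr_1; congr (_ ^+ _).
  apply: succn_inj; rewrite -(size_char_poly A) char_poly_eigenvals.
  by rewrite size_prod_XsubC.
rewrite char_poly_eigenvals !rmorph_prod /= big_map -!big_split /=.
have XsubC_sqr (z : C) : -1 * ('X - z%:P) * (('X - z%:P) \Po - 'X) =
    ('X - (z ^+ 2)%:P) \Po 'X^2.
  rewrite !comp_polyB !comp_polyX !comp_polyC rmorphXn.
  by rewrite mulN1r mulNr -mulrN opprD !opprK subr_sqr.
by rewrite (eq_bigr _ (fun z _ => XsubC_sqr z)).
Qed.

Lemma pseudo_det_mxdiag m (p_ : 'I_m -> nat) (B_ : forall i, 'M[C]_(p_ i)) :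
  pseudo_det (\mxdiag_i B_ i) = \prod_i pseudo_det (B_ i).
Proof.
elim: m p_ B_ => [|m IHm] p_ B_.
  by rewrite [RHS]big_ord0 pseudo_det_dim0 ?big_ord0.
rewrite [RHS]big_ord_recl -IHm.
rewrite (@pseudo_det_roots _ _ (eigenvals (B_ ord0) ++
   eigenvals (\mxdiag_i (B_ (lift ord0 i)))) 0) ?big_cat //=.
by rewrite -!char_poly_eigenvals mul1r !char_poly_mxdiag [LHS]big_ord_recl.
Qed.

(** For a row eigenvector v with eigenvalue z, z <v, v> = <v A^*, v A^*> is nonnegative, so every
    non-zero eigenvalue is positive. *)
Lemma pseudo_det_gram_gt0 m n (A : 'M[C]_(m, n)) :
  0 < pseudo_det (A ^t* *m A).
Proof.
rewrite /pseudo_det big_seq_cond; apply: prodr_gt0 => z /andP[zE z0].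
rewrite lt_def z0 /=.
have /eigenvalueP [v vA v0] : eigenvalue (A^t* *m A) z.
  by rewrite eigenvalue_root_char char_poly_eigenvals root_prod_XsubC.
have := dotmx_is_dotmx v0; move/pmulr_lge0 => <-.
have -> : z * dotmx v v = dotmx (v *m A^t*) (v *m A^t*).
  rewrite !dotmxE trmx_mul map_mxM trmxCK mulmxA -(mulmxA v) vA -scalemxAl.
  by rewrite [RHS]mxE.
have [->|/dotmx_is_dotmx/ltW //] := eqVneq (v *m A^t*) 0.
by rewrite dotmxE mul0mx mxE.
Qed.

End PseudoDet.

(** * Incidence signs and d d = 0 *)

Section Chain.
Variables (disp : Order.disp_t) (V : finOrderType disp) (e : rel V).
Variable C : numClosedFieldType.
Implicit Types (x y z : {set V}) (v w : V).

Lemma facet_simplex k x v :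
  x \in simplices e k.+1 -> v \in x -> x :\ v \in simplices e k.
Proof.
rewrite !inE (cardsD1 v x) => /andP[/eqP xk /forall_inP clx] vx.
rewrite vx add1n in xk; case: xk => ->; rewrite eqxx /=.
apply/forall_inP => u /setD1P[_ ux]; apply/forall_inP => w /setD1P[_ wx].
exact: (forall_inP (clx u ux)).
Qed.

Definition rank_in x v := #|[set w in x | (w < v)%O]|.

Lemma rank_inD1_lt x v w :
  v \in x -> (v < w)%O -> rank_in x w = (rank_in (x :\ v) w).+1.
Proof.
move=> vx vw; rewrite /rank_in (cardsD1 v) !inE vx vw add1n; congr _.+1.
by apply: eq_card => u; rewrite !inE andbA.
Qed.

Lemma rank_inD1_ge x v w : (w <= v)%O -> rank_in (x :\ v) w = rank_in x w.
Proof.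
move=> wv; apply: eq_card => u; rewrite !inE.
by case: eqVneq => //= ->; rewrite ltNge wv andbF.
Qed.

(** Removing the smaller vertex first lowers the rank of the larger by one; removing the larger
    first leaves the rank of the smaller unchanged. The two orders differ by one sign. *)
Lemma rank_sign_antisym x v w :
  v \in x -> w \in x -> v != w ->
  (-1) ^+ rank_in x v * (-1) ^+ rank_in (x :\ v) w
    = - ((-1) ^+ rank_in x w * (-1) ^+ rank_in (x :\ w) v) :> C.
Proof.
wlog vw : v w / (v < w)%O => [hw vx wx vw|].
  case/lt_total/orP: (vw) => ?; first exact: hw.
  by rewrite (hw w v) 1?eq_sym // opprK.
move=> vx wx _.
rewrite (rank_inD1_lt vx vw) (rank_inD1_ge _ (ltW vw)) exprS.
by rewrite mulN1r mulNr opprK mulrC.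
Qed.

(* [F v w] is the contribution of removing [v] first and then [w]; it is
   antisymmetric, and [C] has characteristic 0. *)
Lemma facet_sign_sqr0 x z :
  \sum_(v in x) (-1) ^+ rank_in x v * facet_sign C z (x :\ v) = 0.
Proof.
pose F v w : C := if [&& v \in x, w \in x, v != w & z == x :\ v :\ w]
  then (-1) ^+ rank_in x v * (-1) ^+ rank_in (x :\ v) w else 0.
have -> : \sum_(v in x) (-1) ^+ rank_in x v * facet_sign C z (x :\ v) =
    \sum_v \sum_w F v w.
  rewrite big_mkcond; apply: eq_bigr => v _; rewrite /F.
  case: (v \in x) => /=; last by rewrite big1.
  rewrite mulr_sumr big_mkcond; apply: eq_bigr => w _.
  by rewrite in_setD1 (eq_sym v) -andbA andbCA.
have FN v w : F v w = - F w v.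
  rewrite /F (eq_sym w v) [in RHS]andbCA.
  have -> : x :\ w :\ v = x :\ v :\ w by rewrite !setDDl setUC.
  case: ifP => [/and4P[vx wx vw _]|]; last by rewrite oppr0.
  exact: rank_sign_antisym.
apply/eqP; rewrite -eqNr -sumrN exchange_big; apply/eqP.
apply: eq_bigr => v _; rewrite -sumrN.
by apply: eq_bigr => w _; rewrite FN opprK.
Qed.

Lemma sign_mx_sqr0 k : sign_mx e C k.+2 k.+1 *m sign_mx e C k.+1 k = 0.
Proof.
apply/matrixP => a c; rewrite !mxE.
under eq_bigr do rewrite !mxE.
set x := enum_val a; set z := enum_val c.
rewrite -(big_enum_val (fun y => facet_sign C y x * facet_sign C z y)) /=.
rewrite /facet_sign; under eq_bigr do rewrite -/(facet_sign C z _) mulr_suml.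
(* For each removed vertex v only y = x :\ v contributes, and it is a simplex again, so the sum is
   that of [facet_sign_sqr0]. *)
rewrite (exchange_big_dep (mem x)) /=; last by move=> y v _ /andP[].
rewrite -[RHS](facet_sign_sqr0 x z); apply: eq_bigr => v vx.
rewrite (big_pred1 (x :\ v)) // => y /=; rewrite vx /=.
by case: eqVneq => [->|]; rewrite ?andbF // facet_simplex // enum_valP.
Qed.

Lemma ext_deriv_all_sqr0 : ext_deriv_all e C *m ext_deriv_all e C = 0.
Proof.
(* Index equations let the ordinals of the blocks be used without casts. *)
have sqr0 i j k : i = j.+1 -> j = k.+1 ->
    sign_mx e C i j *m sign_mx e C j k = 0.
  by move=> -> ->; apply: sign_mx_sqr0.
rewrite mul_mxblock -[RHS]mxblock0; apply: eq_mxblock => i k.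
apply: big1 => j _; case: eqP => ij; last by rewrite mul0mx.
by case: eqP => jk; [apply: sqr0 | rewrite mulmx0].
Qed.

(** * Top dimension and block form of d^* d *)

Lemma nsimpl_gt_max_dim : nsimpl e (max_dim e).+1 = 0%N.
Proof.
apply: eq_card0 => x; rewrite !inE; apply/negP => /andP[/eqP xr clx].
have := @leq_bigmax_cond _ (clique e) (fun y : {set V} => #|y|) x clx.
(* The predecessor is truncated: if the largest clique is empty, [max_dim] is 0, and a clique of
   size 2 is still excluded. *)
by rewrite xr /max_dim; case: (\max_(_ | _) _) => // m; rewrite ltnn.
Qed.

Lemma dirac_block_max_dim : dirac_block e C (max_dim e) = 0.
Proof.
apply/matrixP => i j; rewrite !mxE big1 // => -[k kn].
by exfalso; rewrite nsimpl_gt_max_dim in kn.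
Qed.

(** Column k of d has its only possibly non-zero block in row k+1, so distinct block columns are
    orthogonal. *)
Lemma ext_deriv_all_gram :
  (ext_deriv_all e C)^t* *m ext_deriv_all e C
    = \mxdiag_(k < (max_dim e).+1) dirac_block e C k.
Proof.
have -> : (ext_deriv_all e C)^t* =
    \mxblock_(i < (max_dim e).+1, j < (max_dim e).+1)
      (if j == i.+1 :> nat then (sign_mx e C j i)^t* else 0).
  apply/matrixP => s t; rewrite !mxE.
  by case: eqP => _; rewrite !mxE // conjC0.
rewrite mul_mxblock /mxdiag; apply: eq_mxblock => i k.
case: eqVneq => [<-|ik]; last first.
  apply: big1 => j _; case: eqP => ji; last by rewrite mul0mx.
  case: eqP => jk; last by rewrite mulmx0.
  by case/eqP: ik; apply/val_inj/succn_inj; rewrite /= -ji.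
rewrite conform_mx_id.
(* For i = r the sum has no index r+1 and vanishes, which matches D_r = 0; otherwise only j = i+1
   contributes. *)
have [ri|ir] := leqP (max_dim e) i.
  have -> : dirac_block e C i = 0.
    suff -> : i = max_dim e :> nat by apply: dirac_block_max_dim.
    by apply/eqP; rewrite eqn_leq ri -ltnS ltn_ord.
  apply: big1 => j _; case: eqP => ji; last by rewrite mul0mx.
  by exfalso; move: (ltn_ord j); rewrite ji ltnS ltnNge ri.
pose j0 : 'I_(max_dim e).+1 := Ordinal (ir : i.+1 < (max_dim e).+1)%N.
rewrite (bigD1 j0) //= eqxx big1 ?addr0 // => j jj0.
by rewrite ifN ?mul0mx.
Qed.

Lemma pseudo_det_dirac_block_gt0 k : 0 < pseudo_det (dirac_block e C k).
Proof. exact: pseudo_det_gram_gt0. Qed.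

(** Exchanging the two factors gives a matrix of size f_(r+1) = 0. *)
Lemma pseudo_det_dirac_block_max_dim :
  pseudo_det (dirac_block e C (max_dim e)) = 1.
Proof. by rewrite pseudo_det_mulmxC pseudo_det_dim0 // nsimpl_gt_max_dim. Qed.

(** * Pseudo determinants of the Hodge blocks and of the Dirac operator *)

Lemma adjoint_mul m n p (A : 'M[C]_(m, n)) (B : 'M[C]_(n, p)) :
  (A *m B)^t* = B^t* *m A^t*.
Proof. by rewrite trmx_mul map_mxM. Qed.

Lemma adjoint0 m n : (0 : 'M[C]_(m, n))^t* = 0.
Proof. by rewrite trmx0 map_mx0. Qed.

Lemma pseudo_det_hodge_blockS k :
  pseudo_det (hodge_block e C k.+1)
    = pseudo_det (dirac_block e C k.+1) * pseudo_det (dirac_block e C k).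
Proof.
rewrite /hodge_block /dirac_block pseudo_detD_orth.
  by rewrite [in X in _ * X]pseudo_det_mulmxC.
by rewrite mulmxA -[_ *m ext_deriv e C k]mulmxA sign_mx_sqr0 mulmx0 mul0mx.
Qed.

Lemma norm_pseudo_det_dirac :
  `|pseudo_det (dirac e C)| =
    \prod_(k < (max_dim e).+1) pseudo_det (dirac_block e C k).
Proof.
set d := ext_deriv_all e C.
have dd : d *m d = 0 := ext_deriv_all_sqr0.
have dd' : d^t* *m d^t* = 0 by rewrite -adjoint_mul dd adjoint0.
have : pseudo_det (dirac e C) ^+ 2 = pseudo_det (d^t* *m d) ^+ 2.
  rewrite -pseudo_det_sqr /dirac -/d mulmxDl !mulmxDr dd dd' add0r addr0.
  rewrite pseudo_detD_orth; first by rewrite pseudo_det_mulmxC.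
  by rewrite mulmxA -[_ *m d^t*]mulmxA dd' mulmx0 mul0mx.
(* Equal squares give equal moduli, and the right-hand side, being positive, is its own modulus. *)
move/(congr1 Num.norm); rewrite !normrX => /pexpIrn -> //; rewrite ?nnegrE //.
rewrite ext_deriv_all_gram pseudo_det_mxdiag ger0_norm //.
by apply: prodr_ge0 => k _; apply/ltW/pseudo_det_dirac_block_gt0.
Qed.

End Chain.

(** For k < m, [P k] occurs in [L k] and in [L k.+1], and its exponents add up: k(-1)^(k+1) +
    (k+1)(-1)^k = (-1)^k. The last factor [P m] occurs only in [L m]. *)
Lemma prod_alternating (C : fieldType) (L P : nat -> C) m :
  (forall k, P k != 0) -> L 0%N = P 0%N -> (forall k, L k.+1 = P k.+1 * P k) ->
  \prod_(k < m.+1) L k ^ ((k : nat)%:Z * (-1) ^+ k.+1)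
    = (\prod_(k < m) P k ^ ((-1) ^+ k)) * P m ^ (m%:Z * (-1) ^+ m.+1).
Proof.
move=> P0 L0 LS; elim: m => [|m IHm].
  by rewrite big_ord1 big_ord0 L0 [RHS]mul1r.
rewrite big_ord_recr IHm /= LS expfzMl big_ord_recr /= -!mulrA; congr (_ * _).
(* The boundary factor of the induction hypothesis meets the factor [P m] of [L m.+1]. *)
rewrite mulrCA [RHS]mulrC; congr (_ * _).
rewrite -expfzDr //; congr (exprz _ _).
by rewrite !exprS !mulN1r opprK mulrN -addn1 PoszD mulrDl mul1r addKr.
Qed.

Theorem corollary6 (C : numClosedFieldType)
    (disp : Order.disp_t) (V : finOrderType disp) (e : rel V)
    (e_sym : symmetric e) (e_irr : irreflexive e) :
  `|pseudo_det (dirac e C)| * sq_torsion e C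
    = \prod_(k < (max_dim e).+1 | ~~ odd k)
        pseudo_det (dirac_block e C k) ^+ 2
  /\
  `|pseudo_det (dirac e C)| / sq_torsion e C
    = \prod_(k < (max_dim e).+1 | odd k)
        pseudo_det (dirac_block e C k) ^+ 2.
Proof.
pose P k := pseudo_det (dirac_block e C k).
have P0 k : P k != 0 by rewrite gt_eqF // pseudo_det_dirac_block_gt0.
have -> : sq_torsion e C = \prod_(k < (max_dim e).+1) P k ^ ((-1) ^+ k).
  rewrite /sq_torsion (@prod_alternating _
    (fun k => pseudo_det (hodge_block e C k)) P) //.
  2: by move=> k; apply: pseudo_det_hodge_blockS.
  (* The two sides differ only in the exponent of Det D_r = 1. *)
  by rewrite big_ord_recr /= [P _]pseudo_det_dirac_block_max_dim !exp1rz.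
rewrite norm_pseudo_det_dirac -prodfV -!big_split /=.
(* In the product, the factor at k is [P k ^+ 2] for even k and 1 for odd k; dividing by the torsion
   exchanges the parities. *)
split; rewrite [RHS]big_mkcond; apply: eq_bigr => k _.
  rewrite -signr_odd -/(P k); case: (odd k) => /=.
    by rewrite expr1 exprN1 mulfV.
  by rewrite expr0 expr1z expr2.
rewrite -signr_odd -/(P k); case: (odd k) => /=.
  by rewrite expr1 exprN1 invrK expr2.
by rewrite expr0 expr1z mulfV.
Qed.
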